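(* Let $d,e\in\mathbb{N}\setminus\{0\}$ and $\alpha,\beta\in[1,+\infty[$ with $(d,\alpha)\neq(e,\beta)$, $(\alpha,\beta)\neq(1,1)$, and such that either $\beta=1$ and $e\neq0$, or $\alpha=1$ and $d\neq0$. Let $C$ be a finite alphabet. If $x\in C^{\mathbb{N}}$ is both $(d,\alpha)$-substitutive and $(e,\beta)$-substitutive, then $x$ is ultimately periodic.
   Context: A substitution is a morphism $\sigma:A\to A^*$ on a finite alphabet such that some letter $a$ satisfies $|\sigma^n(a)|\to\infty$ and $\sigma(a)=au$ for some word $u$. A fixed point is proper if every letter of $A$ occurs in it. For a non-erasing substitution, each letter $a$ has a growth type $(d(a),\alpha(a))\in\mathbb{N}\times[1,\infty)$: $|\sigma^n(a)|$ is between positive constant multiples of $n^{d(a)}\alpha(a)^n$ for large $n$. The growth type of $\sigma$ is $(D,\Theta)$ with $\Theta=\max_a\alpha(a)$ and $D=\max\{d(a):\alpha(a)=\Theta\}$ (defined up to replacing $\sigma$ by a power, which does not change fixed points). $x\in C^{\mathbb{N}}$ is $(D,\Theta)$-substitutive if $x=\phi(y)$ with $y$ a proper fixed point of a substitution of growth type $(D,\Theta)$ and $\phi$ a letter-to-letter morphism. $x$ is ultimately periodic if $x=uv^\omega$ for words $u$ and $v\neq\epsilon$. *)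

(* Defs.v *)
From mathcomp Require Export all_boot all_order all_algebra.
From mathcomp Require Export boolp classical_sets filter reals topology.

Set Implicit Arguments.
Unset Strict Implicit.
Unset Printing Implicit Defensive.

Import Order.TTheory GRing.Theory Num.Theory.

Local Open Scope classical_set_scope.
Local Open Scope ring_scope.

(* A morphism from A^* to B^* is given by the images of the letters; [morph s]
   is its extension to words.  Infinite words over A are maps [nat -> A]. *)
Definition morph (A B : Type) (s : A -> seq B) (w : seq A) : seq B :=
  flatten [seq s a | a <- w].

Definition morph_iter (A : Type) (s : A -> seq A) (n : nat) (a : A) : seq A :=
  iter n (morph s) [:: a].

Definition substitution (A : finType) (s : A -> seq A) : Prop :=
  exists a : A, (fun n => size (morph_iter s n a)) @ \oo --> \oo /\
                exists u : seq A, s a = a :: u.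

Definition non_erasing (A : finType) (s : A -> seq A) : Prop :=
  forall a : A, s a <> [::].

(* s(y) = z for infinite words.  The words s(y_0 ... y_(n-1)) are prefixes of
   one another, so requiring that each z_i be reached at index i by one of them
   says that they converge to z (in particular that s(y) is infinite). *)
Definition omega_image (A B : Type) (s : A -> seq B)
    (y : nat -> A) (z : nat -> B) : Prop :=
  forall i : nat, exists n : nat, onth (morph s (mkseq y n)) i = Some (z i).

Definition proper_fixed_point (A : finType) (s : A -> seq A) (y : nat -> A)
    : Prop :=
  omega_image s y y /\ forall a : A, exists i : nat, y i = a.

Definition letter_growth (R : realType) (A : finType) (s : A -> seq A) (a : A)
    (d : nat) (alpha : R) : Prop :=
  1 <= alpha /\
  exists c1 c2 : R, [/\ 0 < c1, 0 < c2 &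
    \forall n \near \oo,
      c1 * (n%:R ^+ d * alpha ^+ n) <= (size (morph_iter s n a))%:R
        <= c2 * (n%:R ^+ d * alpha ^+ n)].

(* Growth types of letters, hence of substitutions, are only considered for
   non-erasing s; the growth type of each letter is then unique. *)
Definition growth_type (R : realType) (A : finType) (s : A -> seq A)
    (D : nat) (Theta : R) : Prop :=
  non_erasing s /\
  exists (d : A -> nat) (alpha : A -> R),
    [/\ forall a, letter_growth s a (d a) (alpha a),
        forall a, alpha a <= Theta,
        forall a, alpha a = Theta -> (d a <= D)%N &
        exists a, alpha a = Theta /\ d a = D].

Definition substitutive (R : realType) (C : finType) (D : nat) (Theta : R)
    (x : nat -> C) : Prop :=
  exists (A : finType) (s : A -> seq A) (y : nat -> A) (phi : A -> C),
    [/\ substitution s, growth_type s D Theta, proper_fixed_point s y &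
        forall i, x i = phi (y i)].

(* x = u v v v ... *)
Definition ultimately_periodic (C : Type) (x : nat -> C) : Prop :=
  exists u v : seq C, v <> [::] /\
    forall i : nat, Some (x i) =
      (if (i < size u)%N then onth u i
       else onth v ((i - size u) %% size v)%N).

(* Main.v *)
Require Import Defs.
From mathcomp Require Import zify ring.

Import Order.TTheory GRing.Theory Num.Theory.

(** Write x as a coding of a fixed point of exponential growth and of a fixed
    point z of polynomial growth.  Since z contains growing letters, some letter
    g satisfies T(g) = l g r for a power T of the substitution that is idempotent
    on non-growing words, so T^(n+1)(g) contains T(l)^n and T(r)^n; hence, for
    some p, x has arbitrarily long p-periodic factors.  Let V be the set of
    positions where x_i <> x_(i+p), and suppose that V is infinite; then its gaps
    are unbounded.  A gap of V is determined by the desubstitution depth k at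
    which its two ends become close and by a word of bounded length.  On the
    exponential side k is at most logarithmic in the position, so O(log N)
    distinct gap lengths occur before N.  On the polynomial side the successive
    images of one suitable gap have strictly increasing lengths along an
    arithmetic progression, so at least N^c distinct lengths occur before N, for
    some c > 0: a contradiction.  Hence V is finite and x is ultimately
    periodic. *)

(** * Self-similar colourings and their gaps *)

(* [c] is fixed by a substitution whose image of [c i] occupies the positions
   [f i, ..., f (i+1) - 1]. *)
Definition selfsim {A : Type} (c : nat -> A) (f : nat -> nat) : Prop :=
  [/\ f 0 = 0, forall i, f i < f i.+1 &
   forall i j, c i = c j -> f i.+1 - f i = f j.+1 - f j /\
     forall t, f i + t < f i.+1 -> c (f i + t) = c (f j + t)].

(* Position [j] comes from the letter at position [i]. *)
Definition in_block (f : nat -> nat) (i j : nat) : bool := f i <= j < f i.+1.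

Definition determined_by {A : Type} (c : nat -> A) (V : nat -> Prop) : Prop :=
  forall i j, c i = c j -> V i -> V j.

Definition consec (V : nat -> Prop) (v w : nat) : Prop :=
  [/\ V v, V w, v < w & forall t, v < t < w -> ~ V t].

Lemma pigeonhole (T : finType) (f : nat -> T) :
  exists i j, [/\ i < j, j <= #|T| & f i = f j].
Proof.
have /injectivePn[i [j nij fij]] : ~~ injectiveb (fun k : 'I_#|T|.+1 => f k).
  apply/injectiveP => /leq_card; rewrite card_ord; lia.
have hi := ltn_ord i; have hj := ltn_ord j.
have [lij|lji|eij] := ltngtP i j; last by rewrite (val_inj eij) eqxx in nij.
- by exists i, j; split.
- by exists j, i; split.
Qed.

Section IncreasingMaps.
Variable f : nat -> nat.
Hypothesis fS : forall i, f i < f i.+1.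

Lemma incr_add i m : f i + m <= f (i + m).
Proof. elim: m => [|m IH]; [by rewrite !addn0|rewrite !addnS; have := fS (i + m); lia]. Qed.

Lemma incr_le i j : i <= j -> f i <= f j.
Proof. move=> h; have := incr_add i (j - i); rewrite subnKC //; lia. Qed.

Lemma incr_lt i j : i < j -> f i < f j.
Proof. by move=> /incr_le; apply: leq_trans. Qed.

Lemma incr_inv i j : f i < f j -> i < j.
Proof. by move=> h; rewrite ltnNge; apply/negP => /incr_le; rewrite leqNgt h. Qed.

Lemma incr_ge i : i <= f i.
Proof. by have := incr_add 0 i; rewrite add0n; lia. Qed.

Lemma block_exists v : f 0 = 0 -> exists i, in_block f i v.
Proof.
move=> f0; elim: v => [|v [i /andP[h1 h2]]]; first by exists 0; rewrite /in_block; have := fS 0; lia.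
case: (ltnP v.+1 (f i.+1)) => h; first by exists i; rewrite /in_block h; lia.
by exists i.+1; rewrite /in_block h; have := fS i.+1; lia.
Qed.

Lemma block_le i j v w : in_block f i v -> in_block f j w -> v <= w -> i <= j.
Proof.
move=> /andP[h1 h2] /andP[h3 h4] h.
by rewrite -ltnS; apply: incr_inv; apply: leq_ltn_trans h1 (leq_ltn_trans h h4).
Qed.

Lemma block_lt i j v w : in_block f i v -> in_block f j w -> i < j -> v < w.
Proof.
move=> /andP[h1 h2] /andP[h3 h4] h.
exact: leq_trans h2 (leq_trans (incr_le _ _ h) h3).
Qed.

Lemma block_comp (g : nat -> nat) i j u :
  in_block g i j -> in_block f j u -> in_block (fun i => f (g i)) i u.
Proof.
move=> /andP[h1 h2] /andP[h3 h4]; apply/andP; split.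
  exact: leq_trans (incr_le _ _ h1) h3.
exact: leq_trans h4 (incr_le _ _ h2).
Qed.

Lemma iter_incr k : f 0 = 0 -> iter k f 0 = 0 /\ forall i, iter k f i < iter k f i.+1.
Proof.
move=> f0; elim: k => [|k [IH0 IHS]] //=; split=> [|i]; first by rewrite IH0.
exact: incr_lt.
Qed.

End IncreasingMaps.

Section SelfSimilar.
Variables (A : Type) (c : nat -> A).
Implicit Types (f : nat -> nat) (V : nat -> Prop).

Lemma selfsim_run f m i j : selfsim c f ->
  (forall s, s < m -> c (i + s) = c (j + s)) ->
  f (i + m) - f i = f (j + m) - f j /\
  forall t, f i + t < f (i + m) -> c (f i + t) = c (f j + t).
Proof.
move=> [f0 fS fc]; elim: m => [|m IH] hc; first by rewrite !addn0; split; lia.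
have [|h1 h2] := IH; first by move=> s hs; apply: hc; lia.
have [h3 h4] := fc _ _ (hc m (leqnn _)).
have a1 := incr_add f fS i m; have a2 := incr_add f fS j m.
have b1 := fS (i + m); have b2 := fS (j + m).
rewrite !addnS; split=> [|t ht]; first lia.
case: (ltnP (f i + t) (f (i + m))) => hl; first exact: h2.
have -> : f i + t = f (i + m) + (f i + t - f (i + m)) by lia.
by rewrite h4; [congr c|]; lia.
Qed.

Lemma selfsim_iter f k : selfsim c f -> selfsim c (iter k f).
Proof.
move=> fP; have [f0 fS fc] := fP; have [g0 gS] := iter_incr f fS k f0.
split=> // i j cij; elim: k {g0 gS} => [|k [IH1 IH2]] /=.
  split=> [|t ht]; first lia.
  by have -> : t = 0; [lia|rewrite !addn0].
have [g0 gS] := iter_incr f fS k f0; move: (gS i) (gS j) => gi gj.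
have [|h1 h2] := selfsim_run f (iter k f i.+1 - iter k f i) (iter k f i) (iter k f j) fP.
  by move=> s hs; apply: IH2; lia.
have e1 : iter k f i + (iter k f i.+1 - iter k f i) = iter k f i.+1 by lia.
have e2 : iter k f j + (iter k f i.+1 - iter k f i) = iter k f j.+1 by lia.
by rewrite e1 e2 in h1; rewrite e1 in h2.
Qed.

(** Every block is nonempty, so the images of [p + 1] consecutive letters determine all windows that
    start in the image of the first one. Conditions on [x i] and [x (i + p)] thereby become
    conditions on a single letter. *)
Lemma selfsim_window f p : selfsim c f ->
  selfsim (fun i => [tuple c (i + s) | s < p.+1]) f.
Proof.
move=> fP; have [f0 fS fc] := fP; split=> // i j cij.
have hc s : s < p.+1 -> c (i + s) = c (j + s).
  move=> hs; have /(congr1 (fun u => tnth u (Ordinal hs))) := cij.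
  by rewrite !tnth_mktuple.
have [h1 h2] := selfsim_run f p.+1 i j fP hc.
split; first by apply: (fc _ _ _).1; rewrite -[i]addn0 -[j]addn0 hc.
move=> t ht; apply: eq_from_tnth => s; rewrite !tnth_mktuple -!addnA; apply: h2.
have := incr_add f fS i.+1 p; rewrite addSnnS; have := ltn_ord s; lia.
Qed.

(* The parents of a gap are followed upwards until they are close together,
   which happens when they fall into the same block or below [K]. *)
Lemma gap_ancestors f M K n v w : selfsim c f ->
  (forall i, f i.+1 <= f i + M) -> v < w -> w < iter n f K ->
  exists k l r, [/\ k <= n, l < r, r <= l + (K + M),
                 in_block (iter k f) l v & in_block (iter k f) r w].
Proof.
move=> [f0 fS _] fM; elim: n v w => [|n IH] v w hvw /= hw.
  by exists 0, v, w; rewrite /in_block /= !ltnS !leqnn; split=> //; lia.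
have [l hl] := block_exists f fS v f0; have [r hr] := block_exists f fS w f0.
have hlr := block_le f fS _ _ _ _ hl hr (ltnW hvw).
case: (ltngtP l r) hlr => // [hlr _|elr _]; last first.
  exists 0, v, w; rewrite /in_block /= !ltnS !leqnn; split=> //.
  move: hl hr; rewrite /in_block elr => /andP[h1 h2] /andP[h3 h4].
  by have := fM r; lia.
have hrn : r < iter n f K.
  by apply: (incr_inv f fS); apply: leq_ltn_trans hw; case/andP: hr.
have [k [l' [r' [hk hlr' hd hl' hr']]]] := IH l r hlr hrn.
by exists k.+1, l', r'; split=> //; [apply: block_comp hl' hl|apply: block_comp hr' hr].
Qed.

(** An element of [V] in one block has a copy in [V] at the same offset in any block of the same
    letter. A copy falling strictly inside one of the two gaps is impossible; copying in both
    directions gives opposite inequalities between the offsets. *)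
Lemma gap_offsets f V l r l' r' v w v' w' : selfsim c f -> determined_by c V ->
  l < r -> l' < r' -> c l = c l' -> c r = c r' ->
  consec V v w -> in_block f l v -> in_block f r w ->
  consec V v' w' -> in_block f l' v' -> in_block f r' w' ->
  v - f l = v' - f l' /\ w - f r = w' - f r'.
Proof.
move=> [f0 fS fc] Vc hlr hlr' cl cr.
have key a b : c a = c b -> forall u, in_block f a u -> V u ->
    in_block f b (f b + (u - f a)) /\ V (f b + (u - f a)).
  rewrite /in_block => cab u /andP[h1 h2] Vu.
  have [e1 e2] := fc _ _ cab; have := fS a; have := fS b.
  split; first lia.
  apply: Vc Vu; rewrite -e2; [congr c|]; lia.
move=> [Vv Vw vw nV] bv bw [Vv' Vw' vw' nV'] bv' bw'.
have [k1 K1] := key l l' cl _ bv Vv.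
have [k2 K2] := key r r' cr _ bw Vw.
have [k3 K3] := key l' l (esym cl) _ bv' Vv'.
have [k4 K4] := key r' r (esym cr) _ bw' Vw'.
have q1 := block_lt f fS _ _ _ _ k1 bw' hlr'.
have q2 := block_lt f fS _ _ _ _ bv' k2 hlr'.
have q3 := block_lt f fS _ _ _ _ k3 bw hlr.
have q4 := block_lt f fS _ _ _ _ bv k4 hlr.
have leP a b : (a < b -> False) -> b <= a by move=> h; rewrite leqNgt; apply/negP.
have i1 : f l' + (v - f l) <= v' by apply: leP => h; apply: (nV' _ _ K1); rewrite h.
have i2 : w' <= f r' + (w - f r) by apply: leP => h; apply: (nV' _ _ K2); rewrite h andbT.
have i3 : f l + (v' - f l') <= v by apply: leP => h; apply: (nV _ _ K3); rewrite h.
have i4 : w <= f r + (w' - f r') by apply: leP => h; apply: (nV _ _ K4); rewrite h andbT.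
move: bv bw bv' bw'; rewrite /in_block => /andP[? ?] /andP[? ?] /andP[? ?] /andP[? ?].
lia.
Qed.

(** The word from [l] to [r] fixes the distance from [f l] to [f r], and its end letters fix the
    offsets of [v] and [w]. *)
Lemma gap_determined f V l r l' r' v w v' w' : selfsim c f -> determined_by c V ->
  l < r -> r - l = r' - l' -> (forall s, s <= r - l -> c (l + s) = c (l' + s)) ->
  consec V v w -> in_block f l v -> in_block f r w ->
  consec V v' w' -> in_block f l' v' -> in_block f r' w' ->
  w - v = w' - v'.
Proof.
move=> fP Vc hlr hd hc vw bv bw vw' bv' bw'; have [f0 fS fc] := fP.
have hlr' : l' < r' by lia.
have ed : f r - f l = f r' - f l'.
  have [|] := selfsim_run f (r - l) l l' fP; first by move=> s hs; apply: hc; lia.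
  by have -> : l' + (r - l) = r'; [lia|have -> : l + (r - l) = r by lia].
have cl : c l = c l' by have := hc 0 (leq0n _); rewrite !addn0.
have cr : c r = c r' by have := hc _ (leqnn _); congr (c _ = c _); lia.
have [o1 o2] := gap_offsets _ _ _ _ _ _ _ _ _ _ fP Vc hlr hlr' cl cr vw bv bw vw' bv' bw'.
have g1 := incr_lt f fS _ _ hlr; have g2 := incr_lt f fS _ _ hlr'.
move: bv bw bv' bw'; rewrite /in_block => /andP[? ?] /andP[? ?] /andP[? ?] /andP[? ?].
lia.
Qed.

End SelfSimilar.

Lemma block_size_bound (A : finType) (c : nat -> A) f : selfsim c f ->
  exists M, forall i, f i.+1 <= f i + M.
Proof.
move=> [f0 fS fc].
have [M hM] : exists M, forall a : A, exists m, m <= M /\ forall i, c i = a -> f i.+1 - f i = m.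
  have : forall a : A, exists m, forall i, c i = a -> f i.+1 - f i = m.
    move=> a; have [[i ci]|h] := pselect (exists i, c i = a).
      by exists (f i.+1 - f i) => j cj; apply: (fc j i _).1; rewrite ci.
    (* Letters that do not occur in [c] get the dummy length 0. *)
    by exists 0 => i ci; case: h; exists i.
  move=> /choice[m hm]; exists (\max_a m a) => a; exists (m a).
  by split; [exact: leq_bigmax|exact: hm].
exists M => i; have [m [hm /(_ i erefl)]] := hM (c i).
by have := fS i; lia.
Qed.

(** By [gap_ancestors] a gap ending before [iter n f K] has a code: a depth at most [n], a window of
    letters, and the distance between the two ancestors. By [gap_determined] the code fixes the
    length; [J] counts the codes of a given depth. *)
Lemma few_gaps (A : finType) (c : nat -> A) f V K : selfsim c f ->
  determined_by c V ->
  exists J, forall n m (v w : nat -> nat),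
    (forall i, i < m -> consec V (v i) (w i) /\ w i < iter n f K) ->
    (forall i j, i < j -> j < m -> w i - v i <> w j - v j) ->
    m <= n.+1 * J.
Proof.
move=> fP Vc; have [M hM] := block_size_bound _ _ _ fP; set B := K + M.
exists #|{: B.+1.-tuple A * 'I_B.+1}| => n m v w gaps dist.
rewrite leqNgt; apply/negP => hm.
pose T := ('I_n.+1 * (B.+1.-tuple A * 'I_B.+1))%type.
have /choice[D hD] : forall i, exists D : T, i < m -> exists l r,
    [/\ l < r, r = l + D.2.2, in_block (iter D.1 f) l (v i),
        in_block (iter D.1 f) r (w i) & D.2.1 = [tuple c (l + s) | s < B.+1]].
  move=> i; case: (ltnP i m) => hi; last first.
    (* A dummy code for the indices outside the list of gaps. *)
    by exists (ord0, ([tuple c 0 | s < B.+1], ord0)).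
  have [vw hw] := gaps i hi; case: (vw) => _ _ lvw _.
  have [k [l [r [hk hlr hd hl hr]]]] := gap_ancestors _ _ _ _ _ _ _ _ fP hM lvw hw.
  have hd' : r - l < B.+1 by rewrite /B; lia.
  have hk' : k < n.+1 by lia.
  exists (Ordinal hk', ([tuple c (l + s) | s < B.+1], Ordinal hd')) => _ /=.
  by exists l, r; split=> //; lia.
have [i [j [lij hj eD]]] := pigeonhole _ D.
have hcard : #|{: T}| = n.+1 * #|{: B.+1.-tuple A * 'I_B.+1}|.
  by rewrite card_prod card_ord.
rewrite hcard in hj.
have hjm : j < m by lia.
have him : i < m by lia.
have [l [r [lr er bl br el]]] := hD _ him.
have [l' [r' [lr' er' bl' br' el']]] := hD _ hjm.
rewrite eD in er bl br el.
apply: (dist i j lij hjm).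
have gP := selfsim_iter _ _ _ (D j).1 fP.
apply: (gap_determined _ _ _ _ l r l' r' _ _ _ _ gP Vc) => //; first 1 last.
- move=> s hs; have hsB : s < B.+1 by have := ltn_ord (D j).2.2; lia.
  have := el; rewrite el' => /(congr1 (fun u => tnth u (Ordinal hsB))).
  by rewrite !tnth_mktuple.
- exact: (gaps i him).1.
- exact: (gaps j hjm).1.
- lia.
Qed.

(** * Gaps of strictly increasing length *)

Definition meets (f : nat -> nat) (V : nat -> Prop) (i : nat) : Prop :=
  exists j, in_block f i j /\ V j.

Lemma consec_unique V v w v' w' : consec V v w -> consec V v' w' ->
  v < w' -> v' < w -> v = v' /\ w = w'.
Proof.
move=> [Vv Vw vw nV] [Vv' Vw' vw' nV'] h h'.
have leP a b : (a < b -> False) -> b <= a by move=> ?; rewrite leqNgt; apply/negP.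
have ev : v = v'.
  apply/eqP; rewrite eqn_leq; apply/andP; split; apply: leP => h1.
    by apply: (nV' _ _ Vv); rewrite h1.
  by apply: (nV _ _ Vv'); rewrite h1.
split=> //; apply/eqP; rewrite eqn_leq; apply/andP; split; apply: leP => h1.
  by apply: (nV _ _ Vw'); rewrite h1 andbT ev.
by apply: (nV' _ _ Vw); rewrite h1 andbT -ev.
Qed.

(** Each value determines the next, so the sequence is ultimately periodic; any positive multiple of
    the period lying past the preperiod will do. *)
Lemma eventually_idempotent (T : finType) (S : nat -> T) :
  (forall i j, S i = S j -> S i.+1 = S j.+1) -> exists N, 0 < N /\ S (2 * N) = S N.
Proof.
move=> HS; have [i [j [lij _ eij]]] := pigeonhole _ S.
have shift t : S (i + t) = S (j + t).
  by elim: t => [|t IH]; rewrite ?addn0 // !addnS; apply: HS.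
have per m t : S (i + t + m * (j - i)) = S (i + t).
  elim: m => [|m IH]; first by rewrite mul0n addn0.
  have -> : i + t + m.+1 * (j - i) = j + (t + m * (j - i)) by lia.
  by rewrite -shift -IH; congr S; lia.
(* A multiple of the period [j - i] that is at least [i]. *)
exists ((j - i) * i.+1); split; first by rewrite muln_gt0 subn_gt0 lij.
have := per i.+1 ((j - i) * i.+1 - i).
have -> : i + ((j - i) * i.+1 - i) = (j - i) * i.+1 by nia.
by move=> <-; congr S; lia.
Qed.

(** The states are periodic from some [i] on, and whether [h] increases at a step depends only on
    the state. An increase within one period therefore recurs in every period; without one, [h] is
    constant from [i] on. *)
Lemma stalls_or_grows (T : finType) (S : nat -> T) (h : nat -> nat) :
  (forall i, h i <= h i.+1) ->
  (forall i j, S i = S j -> S i.+1 = S j.+1 /\ (h i.+1 = h i -> h j.+1 = h j)) ->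
  (forall k, h k <= h #|T|) \/ (forall k, h k < h (k + 2 * #|T|)).
Proof.
move=> hS HS; have [i [j [lij ljT eij]]] := pigeonhole _ S.
have mono a b : a <= b -> h a <= h b.
  by apply: (@homo_leq _ h leq leqnn leq_trans).
have shift t : i <= t -> S t = S (t + (j - i)).
  move=> it; rewrite -(subnKC it); elim: (t - i) => [|u IH].
    by rewrite addn0 eij; congr S; lia.
  by rewrite addnS addSn; apply: (HS _ _ IH).1.
have [[t [it tj ht]]|no] := pselect (exists t, [/\ i <= t, t < j & h t < h t.+1]).
  right.
  have ex k : exists u, [/\ k <= u, u.+1 <= k + 2 * #|T|, i <= u & h u < h u.+1].
    elim/ltn_ind: k => k IH.
    case: (leqP k t) => kt; first by exists t; split=> //; lia.
    (* An increase at [u] is repeated one period later. *)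
    have strict u : i <= u -> h u < h u.+1 -> h (u + (j - i)) < h (u + (j - i)).+1.
      move=> iu hu; rewrite ltn_neqAle hS andbT; apply/eqP => e.
      by have := (HS _ _ (esym (shift u iu))).2 (esym e); lia.
    case: (ltnP k j) => kj; first by exists (t + (j - i)); split; [lia..|exact: strict].
    have [|u [h1 h2 h3 h4]] := IH (k - (j - i)); first lia.
    by exists (u + (j - i)); split; [lia..|exact: strict].
  move=> k; have [u [h1 h2 _ h3]] := ex k.
  exact: leq_ltn_trans (mono _ _ h1) (leq_trans h3 (mono _ _ h2)).
left.
have stall t : i <= t -> h t.+1 = h t.
  elim/ltn_ind: t => t IH it.
  case: (ltnP t j) => tj.
    apply/eqP; rewrite eqn_leq hS andbT leqNgt; apply/negP => ht.
    by apply: no; exists t.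
  have [it' tt'] : i <= t - (j - i) /\ t - (j - i) < t by lia.
  have e := shift _ it'; have e' : t - (j - i) + (j - i) = t by lia.
  by rewrite e' in e; apply: (HS _ _ e).2; apply: IH.
have const t : i <= t -> h t = h i.
  move=> it; rewrite -(subnKC it); elim: (t - i) => [|u IH]; first by rewrite addn0.
  by rewrite addnS stall ?leq_addr.
move=> k; case: (leqP k i) => ki; first by apply: mono; lia.
by rewrite (const k (ltnW ki)); apply: mono; lia.
Qed.

Section Gaps.
Variables (A : finType) (c : nat -> A).
Implicit Types (f : nat -> nat) (V L : nat -> Prop) (g h : nat * nat).

(* [g] stands for a pair of consecutive elements of a set of positions.  Its state
   determines the state of the next image and whether that image is longer. *)
Definition gap_state g : A * A * {set A} :=
  (c g.1, c g.2, [set a | `[< exists t, g.1 < t < g.2 /\ c t = a >]]).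

Definition over f g h : Prop := in_block f g.1 h.1 /\ in_block f g.2 h.2.

Lemma meets_ext f V V' i : (forall j, V j <-> V' j) -> meets f V i <-> meets f V' i.
Proof. by move=> e; split=> -[j [h /e]]; exists j. Qed.

Lemma meets_determined f V : selfsim c f -> determined_by c V ->
  determined_by c (meets f V).
Proof.
move=> [f0 fS fc] Vc i j cij [u [/andP[h1 h2] Vu]].
have [e1 e2] := fc _ _ cij; have := fS i; have := fS j => ? ?.
exists (f j + (u - f i)); split; first by rewrite /in_block; lia.
by apply: Vc Vu; rewrite -e2; [congr c|]; lia.
Qed.

Lemma meets_comp (f k : nat -> nat) V i :
  k 0 = 0 -> (forall i, f i < f i.+1) -> (forall i, k i < k i.+1) ->
  meets (fun j => k (f j)) V i <-> meets f (meets k V) i.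
Proof.
move=> k0 fS kS; split=> [[u [/andP[h1 h2] Vu]]|[j [hj [u [hu Vu]]]]].
  have [j hj] := block_exists k kS u k0; exists j; split; last by exists u.
  case/andP: hj => h3 h4; apply/andP; split.
    rewrite -ltnS; apply: (incr_inv k kS); exact: leq_ltn_trans h4.
  by apply: (incr_inv k kS); exact: leq_ltn_trans h2.
by exists u; split=> //; apply: block_comp hj hu.
Qed.

Lemma meets_iterS f n V i : f 0 = 0 -> (forall i, f i < f i.+1) ->
  meets (iter n.+1 f) V i <-> meets f (meets (iter n f) V) i.
Proof.
move=> f0 fS; have [g0 gS] := iter_incr f fS n f0.
have -> : iter n.+1 f = fun j => iter n f (f j) by apply: funext => j; rewrite iterSr.
exact: meets_comp.
Qed.

(* After passing to a power, the set of letters whose image meets [V] is its own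
   preimage, so that the gaps of this set are mapped to gaps of the same set. *)
Lemma meets_stable f V : selfsim c f -> determined_by c V ->
  exists N, 0 < N /\
    forall i, meets (iter N f) V i <-> meets (iter N f) (meets (iter N f) V) i.
Proof.
move=> fP Vc; have [f0 fS fc] := fP.
pose S n := [set a | `[< exists i, c i = a /\ meets (iter n f) V i >]].
have SP n i : meets (iter n f) V i <-> c i \in S n.
  rewrite inE; split=> [h|/asboolP[j [cj]]]; first by apply/asboolP; exists i.
  exact: (meets_determined _ _ (selfsim_iter _ _ _ n fP) Vc).
have iterP n : iter n f 0 = 0 /\ forall i, iter n f i < iter n f i.+1.
  exact: iter_incr.
have [i j eij|N [N0 eN]] := eventually_idempotent _ S.
  apply/setP => a; rewrite !inE.
  (* [S n.+1] depends on [S n] alone, as [eventually_idempotent] requires. *)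
  have step n : `[< exists k, c k = a /\ meets (iter n.+1 f) V k >] =
                `[< exists k, c k = a /\ meets f (fun u => c u \in S n) k >].
    apply: asbool_equiv_eq; split=> -[k [ck hk]]; exists k; split=> //.
      by apply/(meets_ext _ _ _ _ (SP n)); apply/meets_iterS.
    by apply/meets_iterS => //; apply/(meets_ext _ _ _ _ (SP n)).
  by rewrite !step eij.
exists N; split=> // i; have [g0 gS] := iterP N.
rewrite -(meets_comp _ _ V i g0 gS gS).
have -> : (fun j => iter N f (iter N f j)) = iter (2 * N) f.
  by apply: funext => j; rewrite mul2n -addnn iterD.
by rewrite !SP eN.
Qed.

(** Take the last element of [V] in the block of [l] and the first one in the block of [r]. An
    element of [V] strictly between them would have its parent in [L] strictly between [l] and
    [r]. *)
Lemma next_gap f V L l r : f 0 = 0 -> (forall i, f i < f i.+1) ->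
  (forall i, L i <-> meets f V i) -> consec L l r ->
  exists h, consec V h.1 h.2 /\ over f (l, r) h.
Proof.
move=> f0 fS LP [/LP[v0 [bv0 Vv0]] /LP[w0 [bw0 Vw0]] lr nL].
have exV : exists v, in_block f l v && `[< V v >] by exists v0; rewrite bv0; apply/asboolP.
have exW : exists w, in_block f r w && `[< V w >] by exists w0; rewrite bw0; apply/asboolP.
have ub v : in_block f l v && `[< V v >] -> v <= f l.+1 by case/andP=> /andP[_ /ltnW].
case: (ex_maxnP exV ub) => v /andP[bv /asboolP Vv] maxv.
case: (ex_minnP exW) => w /andP[bw /asboolP Vw] minw.
exists (v, w); split; last by split.
split=> //=; first exact: block_lt bv bw lr.
move=> t /andP[vt tw] Vt; have [s bs] := block_exists f fS t f0.
have ls := block_le f fS _ _ _ _ bv bs (ltnW vt).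
have sr := block_le f fS _ _ _ _ bs bw (ltnW tw).
case: (eqVneq s l) => [esl|nsl].
  by have := maxv t; rewrite -esl bs leqNgt vt => /(_ (introT (asboolP _) Vt)).
case: (eqVneq s r) => [esr|nsr].
  by have := minw t; rewrite -esr bs leqNgt tw => /(_ (introT (asboolP _) Vt)).
apply: (nL s); first by rewrite !ltn_neqAle ls sr nsr eq_sym nsl.
by apply/LP; exists t.
Qed.

Lemma unit_steps f a m : (forall t, a <= t -> t < a + m -> f t.+1 = (f t).+1) ->
  f (a + m) = f a + m.
Proof.
elim: m => [|m IH] h; first by rewrite !addn0.
by rewrite !addnS h ?IH //; [move=> t ? ?; apply: h|..]; lia.
Qed.

(** The end letters fix the offsets, and interior blocks are nonempty, so lengths cannot decrease.
    The length is preserved exactly when the offsets are extremal and every interior letter has an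
    image of length 1, which the state can tell. *)
Lemma gap_state_step f V g g' h h' : selfsim c f -> determined_by c V ->
  g.1 < g.2 -> h.1 < h.2 -> consec V g'.1 g'.2 -> consec V h'.1 h'.2 ->
  over f g g' -> over f h h' -> gap_state g = gap_state h ->
  [/\ gap_state g' = gap_state h', g.2 - g.1 <= g'.2 - g'.1 &
      g'.2 - g'.1 = g.2 - g.1 -> h'.2 - h'.1 = h.2 - h.1].
Proof.
case: g => l r; case: h => l' r'; case: g' => v w; case: h' => v' w' /= fP Vc lr lr'.
move=> vw vw' [/= bv bw] [/= bv' bw'] [cl cr] /setP cS.
have [f0 fS fc] := fP.
have [ov ow] := gap_offsets _ _ _ _ _ _ _ _ _ _ _ _ fP Vc lr lr' cl cr vw bv bw vw' bv' bw'.
have mid : forall s, l < s < r -> exists s', l' < s' < r' /\ c s' = c s.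
  move=> s hs; have := cS (c s); rewrite !inE => e.
  by apply/asboolP; rewrite -e; apply/asboolP; exists s.
have mid' : forall s, l' < s < r' -> exists s', l < s' < r /\ c s' = c s.
  move=> s hs; have := cS (c s); rewrite !inE => e.
  by apply/asboolP; rewrite e; apply/asboolP; exists s.
(* A letter inside the new gap comes from the block of [l], of [r] or of an interior letter, and
   each case can be copied. The inclusion is stated for arbitrary gaps so that it can be used in
   both directions. *)
have incl : forall l r l' r' v w v' w', l < r -> l' < r' -> c l = c l' -> c r = c r' ->
    in_block f l v -> in_block f r w -> in_block f l' v' -> in_block f r' w' ->
    v - f l = v' - f l' -> w - f r = w' - f r' ->
    (forall s, l < s < r -> exists s', l' < s' < r' /\ c s' = c s) ->
    forall a, (exists t, v < t < w /\ c t = a) -> exists t, v' < t < w' /\ c t = a.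
  clear -fP; move: (fP) => [f0 fS fc] l r l' r' v w v' w' lr lr' cl cr bv bw bv' bw' ov ow mid.
  move=> a [t [/andP[vt tw] <-]].
  have [s bs] := block_exists f fS t f0.
  have ls := block_le f fS _ _ _ _ bv bs (ltnW vt).
  have sr := block_le f fS _ _ _ _ bs bw (ltnW tw).
  have copy s' : c s' = c s -> in_block f s' (f s' + (t - f s)) /\
      c (f s' + (t - f s)) = c t.
    move: bs => /andP[h1 h2] e; have [e1 e2] := fc _ _ e.
    have := fS s; have := fS s' => ? ?; split; first by rewrite /in_block; lia.
    by rewrite e2; [congr c|]; lia.
  have hl := incr_le f fS _ _ lr'; have hr := incr_le f fS _ _ lr.
  case: (eqVneq s l) => [esl|nsl].
    have [|h1 h2] := copy l'; first by rewrite esl.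
    exists (f l' + (t - f s)); split=> //.
    move: h1 bv bv' bw'; rewrite /in_block esl => /andP[? ?] /andP[? ?] /andP[? ?] /andP[? ?].
    lia.
  case: (eqVneq s r) => [esr|nsr].
    have [|h1 h2] := copy r'; first by rewrite esr.
    exists (f r' + (t - f s)); split=> //.
    move: h1 bs bv' bw bw'; rewrite /in_block esr.
    by move=> /andP[? ?] /andP[? ?] /andP[? ?] /andP[? ?] /andP[? ?]; lia.
  have [|s' [/andP[ls' sr'] cs']] := mid s; first by rewrite !ltn_neqAle ls sr nsr eq_sym nsl.
  have [h1 h2] := copy s' cs'; exists (f s' + (t - f s)); split=> //.
  by rewrite (block_lt f fS _ _ _ _ bv' h1 ls') (block_lt f fS _ _ _ _ h1 bw' sr').
move: (bv) (bw) (bv') (bw'); rewrite /in_block => /andP[? ?] /andP[? ?] /andP[? ?] /andP[? ?].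
have e1 := incr_add f fS l.+1 (r - l.+1); rewrite subnKC // in e1.
have e2 := incr_add f fS l'.+1 (r' - l'.+1); rewrite subnKC // in e2.
split; last 2 first.
- by lia.
- move=> e.
  (* Preserved length forces interior images of length 1; [u2] transfers this to the other gap
     through its set of interior letters. *)
  have u1 t : l < t < r -> f t.+1 = (f t).+1.
    move=> /andP[lt tr]; have := fS t.
    have := incr_add f fS l.+1 (t - l.+1); have := incr_add f fS t.+1 (r - t.+1).
    rewrite !subnKC //; lia.
  have u2 : f r' = f l'.+1 + (r' - l'.+1).
    rewrite -unit_steps ?subnKC // => t h1 h2.
    have [|s [/u1 hs cs]] := mid' t; first by lia.
    by have := (fc _ _ cs).1; have := fS t; lia.
  have := (fc _ _ cl).1; have := fS l; have := fS l'; lia.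
rewrite /gap_state /=; congr (_, _, _).
- have -> : v' = f l' + (v - f l) by lia.
  by rewrite -(fc _ _ cl).2; [congr c|]; lia.
- have -> : w' = f r' + (w - f r) by lia.
  by rewrite -(fc _ _ cr).2; [congr c|]; lia.
apply/setP => a; rewrite !inE; apply: asbool_equiv_eq; split.
- exact: (incl l r l' r' v w v' w').
- exact: (incl l' r' l r v' w' v w).
Qed.

End Gaps.

(** A very long gap of [V] descends from a short gap [(l, r)] of the stable set [L] through
    successive image gaps. If the lengths along this orbit stalled, the descendant could not be so
    long; hence they grow at least linearly, and sparse sampling gives strictly increasing gaps of
    [V]. *)
Lemma growing_gaps (A : finType) (c : nat -> A) f V K : selfsim c f ->
  determined_by c V ->
  (forall B, exists n, B <= iter n f K) ->
  (forall B, exists v w, consec V v w /\ B < w - v) ->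
  exists a K' (v w : nat -> nat),
    (forall k, consec V (v k) (w k) /\ w k < iter (a * k.+1) f K') /\
    (forall i j, i < j -> w i - v i < w j - v j).
Proof.
move=> fP Vc Kinf gaps; have [f0 fS fc] := fP.
have [N [N0 stable]] := meets_stable _ _ _ _ fP Vc.
set p := iter N f in stable; set L := meets p V in stable.
have pP : selfsim c p := selfsim_iter _ _ _ N fP; have [p0 pS pc] := pP.
have Lc : determined_by c L := meets_determined _ _ _ _ pP Vc.
(* At every positive depth, the positions whose image meets [V] form the same set [L]. *)
have LV k i : meets (iter k.+1 p) V i <-> L i.
  elim: k i => [|k IH] i //; rewrite meets_iterS //.
  by rewrite (meets_ext _ _ _ _ IH) stable.
have pK n : iter n f K <= iter n p K.
  rewrite /p -iterM.
  have -> : n * N = n * N.-1 + n by nia.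
  rewrite iterD; have [? gS] := iter_incr f fS (n * N.-1) f0.
  exact: incr_ge.
have [M hM] := block_size_bound _ _ _ pP.
have pM i m : p (i + m) <= p i + M * m.
  elim: m => [|m IH]; first by rewrite !addn0 muln0 addn0.
  by rewrite addnS mulnS; have := hM (i + m); lia.
have lenM V' g h : over p g h -> consec V' h.1 h.2 -> g.1 < g.2 ->
    h.2 - h.1 <= M * (g.2 - g.1).+1.
  case: g h => [l r] [v w] [/= /andP[? ?] /andP[? ?]] _ lr.
  by have := pM l (r - l).+1; rewrite addnS (subnKC (ltnW lr)); move: (M * _) => X; lia.
set Z := #|{: A * A * {set A}}|.
pose B0 := K + M.
pose b n := iter n (fun x => M * x.+1) B0.
(* The term [B0] rules out ancestors at depth 0. The other term exceeds what a stalled orbit can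
   produce: [b Z] bounds its lengths, and the final passage to [V] is bounded by [lenM]. *)
have [v [w [vw large]]] := gaps (B0 + M * (b Z).+1).
have [n hn] := Kinf w.+1.
have [_ _ ltvw _] := vw.
have [k [l [r [_ lr lrB bl br]]]] :=
  gap_ancestors _ _ _ _ _ _ _ _ pP hM ltvw (leq_trans hn (pK n)).
case: k bl br => [|k] bl br.
  by move: bl br; rewrite /in_block /= !ltnS -!eqn_leq => /eqP el /eqP er; lia.
have [Vv Vw _ nV] := vw.
have Llr : consec L l r.
  split=> //; [by apply/(LV k); exists v|by apply/(LV k); exists w|].
  have [_ iS] := iter_incr p pS k.+1 p0.
  move=> t /andP[lt tr] /(LV k)[u [bu Vu]]; apply: (nV u) => //.
  by rewrite (block_lt _ iS _ _ _ _ bl bu lt) (block_lt _ iS _ _ _ _ bu br tr).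
(* [nx] sends a gap of [L] to the next gap of [L], [vx] to a gap of [V]; pairs that are not gaps are
   left unchanged. *)
have /choice[nx nxP] : forall g : nat * nat, exists h, consec L g.1 g.2 ->
    consec L h.1 h.2 /\ over p g h.
  move=> [g1 g2]; have [cg|ncg] := pselect (consec L g1 g2); last by exists (g1, g2).
  by have [h hP] := next_gap p L L g1 g2 p0 pS stable cg; exists h.
have /choice[vx vxP] : forall g : nat * nat, exists h, consec L g.1 g.2 ->
    consec V h.1 h.2 /\ over p g h.
  move=> [g1 g2]; have [cg|ncg] := pselect (consec L g1 g2); last by exists (g1, g2).
  by have [h hP] := next_gap p V L g1 g2 p0 pS (fun=> iff_refl _) cg; exists h.
pose F m := iter m nx (l, r).
have FL m : consec L (F m).1 (F m).2.
  by elim: m => [|m IH] //=; apply: (nxP _ IH).1.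
have Fover m : over p (F m) (F m.+1) := (nxP _ (FL m)).2.
have Flt m : (F m).1 < (F m).2 by have [] := FL m.
have FV m : consec V (vx (F m)).1 (vx (F m)).2 := (vxP _ (FL m)).1.
have FVover m : over p (F m) (vx (F m)) := (vxP _ (FL m)).2.
pose h m := (F m).2 - (F m).1.
have hS m : h m <= h m.+1.
  by have [] := gap_state_step _ _ _ _ _ _ _ _ pP Lc (Flt m) (Flt m) (FL m.+1) (FL m.+1)
    (Fover m) (Fover m) erefl.
have Fblock m : in_block (iter m p) l (F m).1 /\ in_block (iter m p) r (F m).2.
  elim: m => [|m [IH1 IH2]]; first by rewrite /in_block /= !ltnS !leqnn.
  by have [b1 b2] := Fover m; split; [apply: block_comp IH1 b1|apply: block_comp IH2 b2].
have Vblock m : in_block (iter m.+1 p) l (vx (F m)).1 /\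
                in_block (iter m.+1 p) r (vx (F m)).2.
  have [IH1 IH2] := Fblock m; have [b1 b2] := FVover m.
  by split; [apply: block_comp IH1 b1|apply: block_comp IH2 b2].
have [|stall|grow] := stalls_or_grows _ (fun m => gap_state _ c (F m)) h hS.
- move=> i j eS.
  by have [e1 _ e2] := gap_state_step _ _ _ _ _ _ _ _ pP Lc (Flt i) (Flt j) (FL i.+1)
    (FL j.+1) (Fover i) (Fover j) eS.
- exfalso.
  have hb m : h m <= b m.
    elim: m => [|m IH]; first by rewrite /h /b /= /B0; lia.
    have := lenM _ _ _ (Fover m) (FL m.+1) (Flt m); rewrite /b /= -/(b m) -/(h m) -/(h m.+1).
    by move=> H; apply: leq_trans H _; rewrite leq_mul2l; lia.
  have [bv bw] := Vblock k; have [_ iS] := iter_incr p pS k.+1 p0.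
  (* The long gap and the one reached along the orbit have ends in the same two blocks, so they
     overlap and coincide. *)
  have [ev ew] := consec_unique _ _ _ _ _ vw (FV k) (block_lt _ iS _ _ _ _ bl bw lr)
    (block_lt _ iS _ _ _ _ bv br lr).
  have := lenM _ _ _ (FVover k) (FV k) (Flt k); rewrite -ev -ew -/(h k).
  have hk : h k <= b Z := leq_trans (stall k) (hb Z).
  have : M * (h k).+1 <= M * (b Z).+1 by rewrite leq_mul2l ltnS hk orbT.
  lia.
(* In [s] steps [h] gains at least [4 * M + 1]. This beats the error [2 * M] made at each of two
   samples when a gap of [V] is compared with the next gap of [L] ([near]). *)
pose s := 2 * Z * (4 * M).+1.
have hgrow m t : h t + m <= h (t + 2 * Z * m).
  elim: m => [|m IH]; first by rewrite muln0 !addn0.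
  have := grow (t + 2 * Z * m); rewrite -/Z.
  have -> : t + 2 * Z * m + 2 * Z = t + 2 * Z * m.+1 by lia.
  lia.
have hmono i j : i <= j -> h i <= h j.
  by apply: (@homo_leq _ h leq leqnn leq_trans).
have near m : (vx (F m)).2 - (vx (F m)).1 <= h m.+1 + 2 * M /\
    h m.+1 <= (vx (F m)).2 - (vx (F m)).1 + 2 * M.
  have := Fover m; have := FVover m; rewrite /over /in_block /h.
  have := hM (F m).1; have := hM (F m).2; have := incr_le p pS _ _ (Flt m).
  move=> ? ? ? [/andP[? ?] /andP[? ?]] [/andP[? ?] /andP[? ?]].
  lia.
(* The [k]-th gap lies at depth [s * k + 1] for [p], that is [N] times as much for [f], and ends
   before the image of [r + 1]. *)
exists (s.+1 * N), r.+1, (fun k => (vx (F (s * k))).1), (fun k => (vx (F (s * k))).2).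
split=> [m|i j lij].
  split; first exact: FV.
  have [_ /andP[_ b2]] := Vblock (s * m); apply: leq_trans b2 _.
  rewrite /p -iterM.
  have -> : s.+1 * N * m.+1 = (s.+1 * m.+1 - (s * m).+1) * N + (s * m).+1 * N by nia.
  rewrite iterD; have [? gS] := iter_incr f fS ((s.+1 * m.+1 - (s * m).+1) * N) f0.
  exact: incr_ge.
have h1 := (near (s * i)).1; have h2 := (near (s * j)).2.
have h3 := hgrow (4 * M).+1 (s * i).+1; rewrite -/s in h3.
have h4 : h ((s * i).+1 + s) <= h (s * j).+1 by apply: hmono; nia.
lia.
Qed.

(** * Words and fixed points of substitutions *)

Section Morphisms.
Variables (A B : Type) (s : A -> seq B).

Lemma morph_cat u v : morph s (u ++ v) = morph s u ++ morph s v.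
Proof. by rewrite /morph map_cat flatten_cat. Qed.

Lemma morph1 a : morph s [:: a] = s a.
Proof. by rewrite /morph /= cats0. Qed.

End Morphisms.

Definition subword {A : Type} (y : nat -> A) (i n : nat) : seq A :=
  mkseq (fun t => y (i + t)) n.

Lemma mkseqD {A : Type} (y : nat -> A) m n :
  mkseq y (m + n) = mkseq y m ++ subword y m n.
Proof.
rewrite /subword /mkseq iotaD map_cat add0n; congr (_ ++ _).
by rewrite -{1}[m]addn0 iotaDl -map_comp.
Qed.

Lemma onth_mkseq {A : Type} (y : nat -> A) n i : i < n ->
  onth (mkseq y n) i = Some (y i).
Proof.
by move=> h; rewrite onthE (nth_map (y 0)) ?size_mkseq // nth_mkseq.
Qed.

Section FixedPoints.
Variables (A : finType) (s : A -> seq A) (y : nat -> A).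
Hypothesis fix_y : omega_image s y y.

(** The starting point, in the fixed point [y], of the image of [y i]; this is the map [f] of
    [selfsim]. *)
Definition position i := size (morph s (mkseq y i)).

Lemma positionD i n : morph s (mkseq y (i + n)) =
  morph s (mkseq y i) ++ morph s (subword y i n).
Proof. by rewrite mkseqD morph_cat. Qed.

Lemma position_le i n : position i <= position (i + n).
Proof. by rewrite /position positionD size_cat leq_addr. Qed.

(** The images of two prefixes are both prefixes of the image of a longer one, so they agree
    wherever both are defined. *)
Lemma morph_prefix n : morph s (mkseq y n) = mkseq y (position n).
Proof.
apply: eq_from_onth_le => i; rewrite size_mkseq maxnn => hi.
rewrite onth_mkseq //; have [m hm] := fix_y i.
have same a b : i < position a -> onth (morph s (mkseq y (a + b))) i =
    onth (morph s (mkseq y a)) i by move=> h; rewrite positionD onth_cat h.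
rewrite -hm -(same n m) // addnC same //.
by rewrite /position -onthTE hm.
Qed.

Lemma morph_subword i n :
  morph s (subword y i n) = subword y (position i) (position (i + n) - position i).
Proof.
have := morph_prefix (i + n); rewrite positionD -{1}(subnKC (position_le i n)) mkseqD.
rewrite morph_prefix => /(congr1 (drop (position i))).
by rewrite !drop_size_cat // size_mkseq.
Qed.

Lemma iter_position_le k i n : iter k position i <= iter k position (i + n).
Proof.
elim: k => [|k IH] /=; first exact: leq_addr.
by rewrite -(subnKC IH) position_le.
Qed.

Lemma iter_morph_subword k i n : iter k (morph s) (subword y i n) =
  subword y (iter k position i) (iter k position (i + n) - iter k position i).
Proof.
elim: k => [|k IH] /=; first by rewrite addKn.
by rewrite IH morph_subword subnKC // iter_position_le.
Qed.

Lemma morph_iter_subword k i : morph_iter s k (y i) =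
  subword y (iter k position i) (iter k position i.+1 - iter k position i).
Proof.
by rewrite /morph_iter -addn1 -iter_morph_subword /subword /mkseq /= addn0.
Qed.

Lemma selfsim_position : non_erasing s -> selfsim y position.
Proof.
move=> ne.
have bl i : s (y i) = subword y (position i) (position i.+1 - position i).
  by have := morph_iter_subword 1 i; rewrite /morph_iter /= morph1.
have szE i : size (s (y i)) = position i.+1 - position i by rewrite bl size_mkseq.
split=> // [i|i j cij].
  have := szE i; case: (s (y i)) (ne (y i)) => //= a l _; lia.
split=> [|t ht]; first by rewrite -!szE cij.
have ht' : t < position i.+1 - position i by lia.
have ht2 : t < position j.+1 - position j by rewrite -szE -cij szE.
have := congr1 (fun u => nth (y 0) u t) (bl i).
by rewrite cij bl /subword !nth_mkseq.
Qed.

End FixedPoints.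

Section IteratedMorphism.
Variables (A : finType) (s : A -> seq A).

Lemma iter_morph_cat n u v :
  iter n (morph s) (u ++ v) = iter n (morph s) u ++ iter n (morph s) v.
Proof. by elim: n => //= n ->; rewrite morph_cat. Qed.

Lemma iter_morph_nil n : iter n (morph s) [::] = [::].
Proof. by elim: n => //= n ->. Qed.

Lemma iter_morph_cons n a v :
  iter n (morph s) (a :: v) = morph_iter s n a ++ iter n (morph s) v.
Proof. by rewrite -cat1s iter_morph_cat. Qed.

Lemma iter_morph_iter m n a :
  iter m (morph s) (morph_iter s n a) = morph_iter s (m + n) a.
Proof. by rewrite /morph_iter -iterD. Qed.

Lemma size_morph_ge w : non_erasing s -> size w <= size (morph s w).
Proof.
move=> ne; elim: w => //= a w IH.
rewrite -cat1s morph_cat morph1 size_cat.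
by case: (s a) (ne a) => //= b l _; rewrite addSn ltnS; apply: leq_trans IH (leq_addl _ _).
Qed.

Lemma size_iter_morph_ge n w : non_erasing s -> size w <= size (iter n (morph s) w).
Proof.
by move=> ne; elim: n => //= n IH; apply: leq_trans IH (size_morph_ge _ ne).
Qed.

End IteratedMorphism.

Lemma iter_idem (T : Type) (f : T -> T) N x k :
  iter (2 * N) f x = iter N f x -> 0 < k -> iter (k * N) f x = iter N f x.
Proof.
move=> h; case: k => // k _; elim: k => [|k IH]; first by rewrite mul1n.
by rewrite mulSn iterD IH -iterD addnn -mul2n.
Qed.

(** * Growing letters and long powers under polynomial growth *)

Section PolynomialGrowth.
Variables (A : finType) (s : A -> seq A) (deg : A -> nat).
Hypothesis ne : non_erasing s.
Hypothesis upper : forall a, exists C, forall n,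
  size (morph_iter s n a) <= C * n.+1 ^ deg a.
Hypothesis lower : forall a, exists C n0, forall n, n0 <= n ->
  n ^ deg a <= C * size (morph_iter s n a).

Definition growing a := 0 < deg a.

Lemma growing_unbounded a B : growing a -> exists n, B < size (morph_iter s n a).
Proof.
move=> ga; have [C [n0 H]] := lower a.
exists (n0 + (C * B).+1); rewrite ltnNge; apply/negP => h.
have h1 := H (n0 + (C * B).+1) (leq_addr _ _).
have h2 : n0 + (C * B).+1 <= (n0 + (C * B).+1) ^ deg a.
  by rewrite -{1}[n0 + _]expn1 leq_pexp2l // addnS.
have h3 : C * size (morph_iter s (n0 + (C * B).+1) a) <= C * B by rewrite leq_mul2l h orbT.
lia.
Qed.

Lemma nongrowing_bounded : exists C, forall a n, ~~ growing a ->
  size (morph_iter s n a) <= C.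
Proof.
have [C HC] := choice upper; exists (\max_a C a) => a n; rewrite -eqn0Ngt => /eqP d0.
by have := HC a n; rewrite d0 expn0 muln1 => h; apply: leq_trans h (leq_bigmax _).
Qed.

Lemma nongrowing_word_bounded w : ~~ has growing w ->
  exists C, forall n, size (iter n (morph s) w) <= C.
Proof.
have [C HC] := nongrowing_bounded => hw; exists (C * size w) => n.
elim: w hw => [|a w IH] /=; first by rewrite iter_morph_nil.
rewrite negb_or => /andP[ha /IH hw]; rewrite iter_morph_cons size_cat mulnS.
by apply: leq_add; rewrite ?HC.
Qed.

Lemma sub_size_iter_morph n w b : b \in w ->
  size (morph_iter s n b) <= size (iter n (morph s) w).
Proof.
by case/splitPr => u v; rewrite iter_morph_cat iter_morph_cons !size_cat; lia.
Qed.

(** A word has a growing letter exactly when its iterates are unbounded, and this does not change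
    when the word is replaced by one of its iterates. *)
Lemma has_growing n w : has growing (iter n (morph s) w) = has growing w.
Proof.
apply/idP/idP => h; apply/negPn/negP => h'.
  have [C HC] := nongrowing_word_bounded w h'.
  case/hasP: h => b hb gb; have [m hm] := growing_unbounded b C gb.
  have := sub_size_iter_morph m _ _ hb; rewrite -iterD.
  by have := HC (m + n); lia.
have [C HC] := nongrowing_word_bounded _ h'.
case/hasP: h => b hb gb; have [m hm] := growing_unbounded b (C + size (iter n (morph s) w)) gb.
have := sub_size_iter_morph m _ _ hb.
have := HC m; rewrite -iterD addnC iterD.
by have := size_iter_morph_ge _ s n (iter m (morph s) w) ne; lia.
Qed.

Lemma count_growing_mono n w : count growing w <= count growing (iter n (morph s) w).
Proof.
elim: w => [|a w IH] //=; rewrite iter_morph_cons count_cat; apply: leq_add => //.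
case ga: (growing a) => //=; rewrite -has_count.
by rewrite /morph_iter has_growing /= ga.
Qed.

(* Among growing letters take one of minimal degree d: each growing letter of
   its m-th image contributes at least a multiple of n^d to the length of the
   (n+m)-th image, which is of order n^d. *)
Lemma bounded_growing_count : (exists a, growing a) ->
  exists g C, growing g /\ forall n, count growing (morph_iter s n g) <= C.
Proof.
move=> [g0 gg0]; case: (@arg_minnP _ g0 growing deg gg0) => g gg ming.
have [C1 [n0 low]] : exists C n0, forall a n, growing a -> n0 <= n ->
    n ^ deg a <= C * size (morph_iter s n a).
  have [C HC] := choice lower; have [n0 Hn] := choice HC.
  exists (\max_a C a), (\max_a n0 a) => a n _ hn.
  have h : n0 a <= n by apply: leq_trans hn; apply: leq_bigmax.
  apply: leq_trans (Hn a n h) _; rewrite leq_mul2r; apply/orP; right.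
  exact: leq_bigmax.
have [C2 up] := upper g.
exists g, (C1 * C2 * 3 ^ deg g); split=> // m.
(* With [n] above both [n0] and [m], [n + m + 1] is at most [3 * n]; hence the factor
   [3 ^ deg g]. *)
pose n := n0 + m.+1.
have sum w : count growing w * n ^ deg g <= C1 * size (iter n (morph s) w).
  elim: w => [|a w IH] //=; rewrite iter_morph_cons size_cat mulnDl mulnDr.
  apply: leq_add => //; case ga: (growing a) => //; rewrite mul1n.
  apply: leq_trans (low a n ga (leq_addr _ _)).
  by rewrite leq_pexp2l ?ming // /n addnS.
have := sum (morph_iter s m g); rewrite iter_morph_iter => h1.
have h2 := up (n + m).
have h3 : (n + m).+1 ^ deg g <= 3 ^ deg g * n ^ deg g.
  by rewrite -expnMn leq_exp2r //; rewrite /n; lia.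
have h4 : 0 < n ^ deg g by rewrite expn_gt0 /n addnS.
rewrite -(leq_pmul2r h4); apply: leq_trans h1 _.
have : C1 * size (morph_iter s (n + m) g) <= C1 * (C2 * (n + m).+1 ^ deg g).
  by rewrite leq_mul2l h2 orbT.
move=> h5; apply: leq_trans h5 _; rewrite -!mulnA leq_mul2l; apply/orP; right.
by rewrite leq_mul2l h3 orbT.
Qed.

(** Take the least bound [m] valid for some growing letter; it is attained by some image. There each
    of the [m] growing letters keeps at least one growing descendant, so none can ever have two. *)
Lemma unique_growing : (exists a, growing a) ->
  exists g, forall n, count growing (morph_iter s n g) = 1.
Proof.
move=> /bounded_growing_count[g0 [C0 [gg0 hg0]]].
pose P m := `[< exists g, growing g /\ forall n, count growing (morph_iter s n g) <= m >].
have exP : exists m, P m by exists C0; apply/asboolP; exists g0.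
case: (ex_minnP exP) => m /asboolP[g [gg hg]] minm.
have m0 : 0 < m by have := hg 0; rewrite /= gg.
have [n0 hn0] : exists n, count growing (morph_iter s n g) = m.
  apply: contrapT => no; have : m <= m.-1; last lia.
  apply: minm; apply/asboolP; exists g; split=> // n.
  have := hg n; rewrite leq_eqVlt => /orP[/eqP e|]; last lia.
  by case: no; exists n.
have : has growing (morph_iter s n0 g) by rewrite has_count hn0.
case/hasP => b hb gb; exists b => n.
apply/eqP; rewrite eqn_leq; apply/andP; split; last first.
  by have := count_growing_mono n [:: b]; rewrite /= gb.
have := hg (n + n0); rewrite -iter_morph_iter.
case/splitPr: hb hn0 => u v; rewrite !count_cat /= gb => hn0.
rewrite iter_morph_cat iter_morph_cons !count_cat.
have := count_growing_mono n u; have := count_growing_mono n v; lia.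
Qed.

Definition power (W : seq A) n : seq A := flatten (nseq n W).

Lemma powerSr W n : power W n.+1 = power W n ++ W.
Proof. by rewrite /power -addn1 nseqD flatten_cat /= cats0. Qed.

Lemma iter_morph_power W k n : iter k (morph s) W = W ->
  iter k (morph s) (power W n) = power W n.
Proof.
move=> eW; elim: n => [|n IH]; first exact: iter_morph_nil.
by rewrite /power /= iter_morph_cat eW -/(power W n) IH.
Qed.

Lemma nongrowing_idempotent : exists N, 0 < N /\ forall a, ~~ growing a ->
  morph_iter s (2 * N) a = morph_iter s N a.
Proof.
have [C HC] := nongrowing_bounded.
(* Growing letters get a dummy empty word, so that [X] takes values in a finite type. *)
pose X n : {ffun A -> C.-bseq A} :=
  [ffun a => if growing a then [bseq] else insub_bseq C (morph_iter s n a)].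
have XP n a : ~~ growing a -> X n a = morph_iter s n a :> seq A.
  by move=> ga; rewrite ffunE (negPf ga); apply: insubdK; apply: HC.
have [i j eX|N [N0 eN]] := eventually_idempotent _ X.
  apply/ffunP => a; case ga: (growing a); first by rewrite !ffunE ga.
  have ga' : ~~ growing a by rewrite ga.
  by apply: val_inj => /=; rewrite !XP // /morph_iter !iterS -!/(morph_iter _ _ _) -!XP // eX.
by exists N; split=> // a ga; rewrite -!XP // eN.
Qed.

(** Following the unique growing letter of each image is a map on a finite alphabet; an idempotent
    power of it yields a letter that returns to itself. *)
Lemma recurrent_growing : (exists a, growing a) ->
  exists g N, [/\ 0 < N, forall n, count growing (morph_iter s n g) = 1 &
                 forall k, g \in morph_iter s (k * N) g].
Proof.
move=> /unique_growing[g0 hg0].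
pose nx a := odflt a [pick b | growing b && (b \in s a)].
pose U a := forall n, count growing (morph_iter s n a) = 1.
have Unx a : U a -> nx a \in s a /\ U (nx a).
  move=> Ua; rewrite /nx; case: pickP => [b /andP[gb hb]|no] /=; last first.
    have := Ua 1; rewrite /morph_iter /= morph1 => h1.
    have : has growing (s a) by rewrite has_count h1.
    by case/hasP => b hb gb; have := no b; rewrite gb hb.
  split=> // n; have := Ua n.+1; rewrite {1}/morph_iter iterSr morph1.
  have := Ua 1; rewrite {1}/morph_iter /= morph1.
  case/splitPr: hb => u v; rewrite iter_morph_cat (iter_morph_cons _ s n b v) !count_cat /= gb.
  by have := count_growing_mono n [:: b]; rewrite -/(morph_iter s n b) /= gb /=; lia.
have Uit n a : U a -> iter n nx a \in morph_iter s n a /\ U (iter n nx a).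
  move=> Ua; elim: n => [|n [IH1 IH2]]; first by rewrite /morph_iter /= mem_head.
  have [h1 h2] := Unx _ IH2; split=> //=.
  by rewrite /morph_iter /= /morph; apply/flatten_mapP; exists (iter n nx a).
have [i j eij|N [N0 eN]] := eventually_idempotent _ (fun n => iter n nx g0).
  by rewrite /= eij.
have Ug := (Uit N g0 hg0).2.
exists (iter N nx g0), N; split=> // k.
have := (Uit (k * N) _ Ug).1; rewrite -iterD -mulSnr.
by rewrite (iter_idem _ nx N g0 k.+1 eN).
Qed.

Lemma long_powers : (exists a, growing a) ->
  exists W g, W <> [::] /\ forall n, exists m u v,
    morph_iter s m g = u ++ power W n ++ v.
Proof.
move=> /recurrent_growing[g [N1 [N10 gcount gin]]].
have [N2 [N20 idem]] := nongrowing_idempotent.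
(* A common multiple: [g] recurs in [T [:: g]], and [T] is idempotent on words without growing
   letters. *)
pose N := N1 * N2; pose T := iter N (morph s).
have Tcat u v : T (u ++ v) = T u ++ T v by apply: iter_morph_cat.
have Tcons a v : T (a :: v) = T [:: a] ++ T v by rewrite -cat1s Tcat.
have Tidem w : ~~ has growing w -> T (T w) = T w.
  elim: w => [|a w IH] /=; first by rewrite /T !iter_morph_nil.
  rewrite negb_or => /andP[ha hw]; rewrite Tcons Tcat (IH hw); congr (_ ++ _).
  have e k : 0 < k -> iter (k * N2) (morph s) [:: a] = iter N2 (morph s) [:: a].
    by apply: iter_idem; apply: idem.
  by rewrite /T -iterD /N -mulnDl !e // addn_gt0 N10.
have := gin N2; rewrite mulnC -/N => gN; have := gcount N.
case E: _ / (splitPr gN) => [l r].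
rewrite count_cat /=.
have TgE : T [:: g] = l ++ g :: r := E.
have Tpower W n : T W = W -> T (power W n) = power W n by apply: iter_morph_power.
have gg : growing g by have := gcount 0; rewrite /=; case: (growing g).
rewrite gg => cnt.
have hl : ~~ has growing l by rewrite has_count; lia.
have hr : ~~ has growing r by rewrite has_count; lia.
have stepT n u v : iter n T [:: g] = u ++ g :: v -> iter n.+1 T [:: g] = T u ++ (l ++ g :: r) ++ T v.
  by move=> e; rewrite iterS e Tcat (Tcons g v) TgE.
have itT n : iter n T [:: g] = morph_iter s (n * N) g by rewrite /T -iterM.
have Tne w : w <> [::] -> T w <> [::].
  by case: w => // a w _ e; have := size_iter_morph_ge _ s N (a :: w) ne; move: e; rewrite /T => ->.
have right n : exists u, iter n.+1 T [:: g] = u ++ g :: r ++ power (T r) n.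
  elim: n => [|n [u IH]]; first by exists l; rewrite /= TgE /power /= cats0.
  exists (T u ++ l); rewrite (stepT _ _ _ IH) Tcat Tpower ?Tidem //=.
  by rewrite -!catA.
have left n : exists v, iter n.+1 T [:: g] = power (T l) n ++ l ++ g :: v.
  elim: n => [|n [v IH]]; first by exists r; rewrite /= TgE.
  exists (r ++ T v); rewrite (stepT n.+1 (power (T l) n ++ l) v); last by rewrite IH -catA.
  by rewrite Tcat Tpower ?Tidem // powerSr -!catA.
case: (eqVneq r [::]) => [r0|/eqP rn]; last first.
  exists (T r), g; split; first exact: Tne.
  move=> n; have [u hu] := right n; exists (n.+1 * N), (u ++ g :: r), [::].
  by rewrite -itT hu cats0 -catA.
case: (eqVneq l [::]) => [l0|/eqP ln]; last first.
  exists (T l), g; split; first exact: Tne.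
  move=> n; have [v hv] := left n; exists (n.+1 * N), [::], (l ++ g :: v).
  by rewrite -itT hv.
(* If [l] and [r] were both empty, [T] would fix [g], which is growing. *)
have fixg n : iter n T [:: g] = [:: g].
  elim: n => // n IH; rewrite (stepT n [::] [::]) ?IH // l0 r0.
  by rewrite /T iter_morph_nil.
have [n hn] := growing_unbounded g 1 gg.
have := size_iter_morph_ge _ s (n * N - n) (morph_iter s n g) ne.
rewrite iter_morph_iter subnK; last by rewrite leq_pmulr // muln_gt0 N10.
by rewrite -itT fixg /=; lia.
Qed.

End PolynomialGrowth.

(** * Exponential against polynomial growth *)

Lemma power_periodic (T : Type) (x0 : T) (W : seq T) n t :
  t + size W < size (flatten (nseq n W)) ->
  nth x0 (flatten (nseq n W)) t = nth x0 (flatten (nseq n W)) (t + size W).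
Proof.
case: n => [|n] //; rewrite {1}[flatten _]/= size_cat addnC ltn_add2l => ht.
have -> : nth x0 (flatten (nseq n.+1 W)) (size W + t) = nth x0 (flatten (nseq n W)) t.
  by rewrite /= nth_cat ltnNge leq_addr /= addKn.
by rewrite -addn1 nseqD flatten_cat nth_cat ht.
Qed.

Section PolynomialFixedPoint.
Variables (A : finType) (s : A -> seq A) (deg : A -> nat) (y : nat -> A).
Hypothesis ne : non_erasing s.
Hypothesis fix_y : proper_fixed_point s y.
Hypothesis upper : forall a, exists C, forall n,
  size (morph_iter s n a) <= C * n.+1 ^ deg a.
Hypothesis lower : forall a, exists C n0, forall n, n0 <= n ->
  n ^ deg a <= C * size (morph_iter s n a).
Hypothesis grow : exists a, 0 < deg a.

Lemma periodic_runs : exists p, 0 < p /\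
  forall n, exists i, forall t, t < n -> y (i + t) = y (i + t + p).
Proof.
have [W [g [W0 HW]]] := long_powers _ s deg ne upper lower grow.
have szW : 0 < size W by case: W W0 {HW}.
exists (size W); split=> // n.
(* One copy of [W] more than [n], since position [t] is compared with [t + size W]. *)
have [m [u [v]]] := HW n.+1; have [j <-] := fix_y.2 g.
rewrite (morph_iter_subword _ _ _ fix_y.1).
set i := iter m _ j; set k := _ - i => e.
have sz := congr1 size e; rewrite size_mkseq [size (u ++ _)]size_cat [size (_ ++ v)]size_cat in sz.
have szP : size (power _ W n.+1) = n.+1 * size W.
  by rewrite /power size_flatten /shape map_nseq sumn_nseq mulnC.
have sub t : t < size (power _ W n.+1) -> y (i + size u + t) = nth (y 0) (power _ W n.+1) t.
  move=> ht; have := congr1 (fun w => nth (y 0) w (size u + t)) e.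
  rewrite nth_mkseq; last lia.
  by rewrite addnA nth_cat ltnNge leq_addr /= addKn nth_cat ht.
exists (i + size u) => t ht; rewrite -[_ + t + _]addnA.
have ht2 : t + size W < size (power _ W n.+1).
  by rewrite szP mulSn; have := leq_pmulr n szW; lia.
rewrite !sub //; first exact: power_periodic.
lia.
Qed.

(** The left side is the length of the [n]-th image of the prefix of length [K]. *)
Lemma position_polynomial K : exists C E, forall n,
  iter n (position _ s y) K <= C * n.+1 ^ E.
Proof.
pose E := \max_a deg a.
have [C0 HC0] := choice upper.
have [C HC] : exists C, forall n, size (iter n (morph s) (subword y 0 K)) <= C * n.+1 ^ E.
  elim: (subword y 0 K) => [|a w [C IH]].
    by exists 0 => n; rewrite iter_morph_nil.
  exists (C0 a + C) => n; rewrite iter_morph_cons size_cat mulnDl; apply: leq_add => //.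
  apply: leq_trans (HC0 a n) _; rewrite leq_mul2l leq_pexp2l ?orbT //.
  exact: leq_bigmax.
exists C, E => n; have := HC n.
have z k : iter k (position _ s y) 0 = 0 by elim: k => //= k ->.
by rewrite (iter_morph_subword _ _ _ fix_y.1) size_mkseq add0n z subn0.
Qed.

Lemma position_unbounded : exists K, forall B, exists n,
  B <= iter n (position _ s y) K.
Proof.
have [g gg] := grow; have [i yi] := fix_y.2 g.
exists i.+1 => B; have [n hn] := growing_unbounded _ s deg lower g B gg.
exists n; move: hn; rewrite -yi (morph_iter_subword _ _ _ fix_y.1) size_mkseq; lia.
Qed.

End PolynomialFixedPoint.

Lemma long_runs_gaps (V : nat -> Prop) :
  (forall n, exists i, n <= i /\ V i) ->
  (forall n, exists i, forall t, t < n -> ~ V (i + t)) ->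
  forall B, exists v w, consec V v w /\ B < w - v.
Proof.
move=> Vinf runs B.
(* A run longer than [v0] cannot start at or before [v0], so [V] has an element on each side of
   it. *)
have [v0 [_ Vv0]] := Vinf 0; have [i hi] := runs (v0 + B).+2.
have v0i : v0 < i.
  rewrite ltnNge; apply/negP => h; apply: (hi (v0 - i)); first lia.
  by rewrite subnKC.
have [w0 [iw0 Vw0]] := Vinf i.
have exv : exists v, (v <= i) && `[< V v >] by exists v0; rewrite ltnW //; apply/asboolP.
have exw : exists w, (i <= w) && `[< V w >] by exists w0; rewrite iw0; apply/asboolP.
have ub v : (v <= i) && `[< V v >] -> v <= i by case/andP.
case: (ex_maxnP exv ub) => v /andP[vi /asboolP Vv] maxv.
case: (ex_minnP exw) => w /andP[iw /asboolP Vw] minw.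
have wfar : i + (v0 + B).+2 <= w.
  rewrite leqNgt; apply/negP => h; apply: (hi (w - i)); first lia.
  by rewrite subnKC.
exists v, w; split; last lia.
split=> //; first lia.
move=> t /andP[vt tw] Vt; case: (leqP t i) => ti.
  by have := maxv t; rewrite ti leqNgt vt => /(_ (introT (asboolP _) Vt)).
by have := minw t; rewrite (ltnW ti) leqNgt tw => /(_ (introT (asboolP _) Vt)).
Qed.

Lemma eventually_periodic (C : Type) (x : nat -> C) N p : 0 < p ->
  (forall i, N <= i -> x i = x (i + p)) -> ultimately_periodic x.
Proof.
move=> p0 per; exists (mkseq x N), (subword x N p); split.
  by move=> /(congr1 size); rewrite size_mkseq /= => e; rewrite e in p0.
move=> i; rewrite /subword !size_mkseq; case: ltnP => iN; first by rewrite onth_mkseq.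
rewrite onth_mkseq ?ltn_mod //; congr Some.
have many q j : N <= j -> x (j + q * p) = x j.
  move=> Nj; elim: q => [|q IH]; first by rewrite mul0n addn0.
  by rewrite mulSnr addnA -per // (leq_trans Nj (leq_addr _ _)).
rewrite -(many ((i - N) %/ p) _ (leq_addr _ N)); congr x.
by rewrite -addnA [_ %% p + _]addnC -divn_eq subnKC.
Qed.

Lemma exponential_polynomial (C A1 A2 : finType) (s1 : A1 -> seq A1) (s2 : A2 -> seq A2)
    (y1 : nat -> A1) (y2 : nat -> A2) (phi1 : A1 -> C) (phi2 : A2 -> C)
    (deg : A2 -> nat) (K1 : nat) (x : nat -> C) :
  non_erasing s1 -> proper_fixed_point s1 y1 -> (forall i, x i = phi1 (y1 i)) ->
  non_erasing s2 -> proper_fixed_point s2 y2 -> (forall i, x i = phi2 (y2 i)) ->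
  (forall D E, exists n, D * n.+1 ^ E < iter n (position _ s1 y1) K1) ->
  (forall a, exists D, forall n, size (morph_iter s2 n a) <= D * n.+1 ^ deg a) ->
  (forall a, exists D n0, forall n, n0 <= n ->
     n ^ deg a <= D * size (morph_iter s2 n a)) ->
  (exists a, 0 < deg a) ->
  ultimately_periodic x.
Proof.
move=> ne1 fix1 x1 ne2 fix2 x2 expo upper lower grow.
have [p [p0 runs]] := periodic_runs _ s2 deg y2 ne2 fix2 upper lower grow.
pose V i := x i <> x (i + p).
have [[N HN]|Vinf] := pselect (exists N, forall i, N <= i -> ~ V i).
  by apply: (eventually_periodic _ x N p p0) => i /HN; apply: contrapT.
(* Membership in [V] looks [p] letters ahead, hence windows of [p + 1] letters. *)
have Vdet (A : finType) (y : nat -> A) (phi : A -> C) : (forall i, x i = phi (y i)) ->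
    determined_by (fun i => [tuple y (i + t) | t < p.+1]) V.
  move=> xE i j eij; rewrite /V !xE.
  have e t : t <= p -> y (i + t) = y (j + t).
    move=> ht; have /(congr1 (fun u => tnth u (Ordinal (ht : t < p.+1)))) := eij.
    by rewrite !tnth_mktuple.
  by have := e 0 (leq0n p); rewrite !addn0 (e p) // => ->.
have gaps : forall B, exists v w, consec V v w /\ B < w - v.
  apply: long_runs_gaps => n.
    apply: contrapT => no; apply: Vinf; exists n => i ni Vi; apply: no; by exists i.
  have [i hi] := runs n; exists i => t tn; apply; rewrite !x2; congr phi2; exact: hi.
have [K2 unb] := position_unbounded _ s2 deg y2 fix2 lower grow.
have ss1 := selfsim_window _ _ _ p (selfsim_position _ s1 y1 fix1.1 ne1).
have ss2 := selfsim_window _ _ _ p (selfsim_position _ s2 y2 fix2.1 ne2).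
have [a [K' [v [w [vwP vwlt]]]]] := growing_gaps _ _ _ _ _ ss2 (Vdet _ _ _ x2) unb gaps.
have [J HJ] := few_gaps _ _ _ _ K1 ss1 (Vdet _ _ _ x1).
have [D [E HD]] := position_polynomial _ s2 deg y2 fix2 upper K'.
(* The first [(n + 1) * J + 1] growing gaps end below this polynomial bound in [n], hence before
   [iter n (position _ s1 y1) K1], one more than [few_gaps] allows. *)
have [n hn] := expo (D * (a * J.+2).+1 ^ E) E.
have := HJ n (n.+1 * J).+1 v w; rewrite ltnn => H.
suff : false by []; apply: H => [i hi|i j lij _]; last first.
  by have := vwlt i j lij; lia.
have [vwi wi] := vwP i; split=> //.
apply: leq_trans (leq_trans wi (HD (a * i.+1))) (leq_trans _ (ltnW hn)).
rewrite -mulnA leq_mul2l -expnMn; apply/orP; right.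
case: (posnP E) => [->|E0]; first by rewrite !expn0.
by rewrite leq_exp2r //; nia.
Qed.

(** * Growth estimates over the reals and the conclusion *)

Local Open Scope ring_scope.

Section Growth.
Variable R : realType.

(** Bernoulli gives [g ^+ s >= s.+1%:R * h]. For [n = s * E.+1], the power [g ^+ n] then dominates a
    multiple of the power [E + 1] of [s + 1], against the power [E] on the other side. *)
Lemma exp_beats_poly (g c : R) (D E n0 : nat) : 1 < g -> 0 < c ->
  exists n, (n0 <= n)%N /\ (D * n.+1 ^ E)%:R < c * g ^+ n.
Proof.
move=> g1 c0; pose h := Num.min 1 (g - 1).
have h0 : 0 < h by rewrite lt_min ltr01 subr_gt0.
have bern s : s.+1%:R * h <= g ^+ s.
  apply: (@le_trans _ _ (1 + s%:R * (g - 1))).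
    rewrite -natr1 mulrDl mul1r addrC lerD //; first by rewrite /h ge_min lexx.
    by rewrite ler_wpM2l // /h ge_min lexx orbT.
  elim: s => [|s IH]; first by rewrite mul0r addr0 expr0.
  rewrite exprSr; apply: le_trans (ler_wpM2r _ IH); last by rewrite ltW // (lt_trans ltr01).
  rewrite -subr_ge0.
  have -> : (1 + s%:R * (g - 1)) * g - (1 + s.+1%:R * (g - 1)) = s%:R * (g - 1) ^+ 2.
    by rewrite -natr1; ring.
  by rewrite mulr_ge0 // sqr_ge0.
pose q := (D * E.+1 ^ E)%:R / (c * h ^+ E.+1).
have q0 : 0 <= q by rewrite divr_ge0 // mulr_ge0 ?exprn_ge0 // ltW.
pose s := (n0 + Num.bound q)%N.
have sq : q < s.+1%:R.
  apply: lt_le_trans (archi_boundP q0) _; rewrite ler_nat /s; lia.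
exists (s * E.+1)%N; split; first by rewrite /s; nia.
rewrite exprM; apply: (@lt_le_trans _ _ (c * (s.+1%:R * h) ^+ E.+1)); last first.
  by rewrite ler_pM2l // lerXn2r ?nnegrE ?mulr_ge0 ?exprn_ge0 // ?ltW // (lt_trans ltr01).
apply: (@le_lt_trans _ _ ((D * E.+1 ^ E) * s.+1 ^ E)%:R).
  rewrite ler_nat -mulnA -expnMn leq_mul2l; apply/orP; right.
  by case: (posnP E) => [->|E0]; rewrite ?expn0 // leq_exp2r //; nia.
rewrite exprMn mulrCA -ltr_pdivrMr ?mulr_gt0 ?exprn_gt0 //.
rewrite natrM -/q mulrAC -/q natrX exprSr mulrC.
by rewrite ltr_pM2l ?exprn_gt0.
Qed.


Lemma polynomial_upper (A : finType) (s : A -> seq A) a d :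
  letter_growth s a d (1 : R) ->
  exists C, forall n, (size (morph_iter s n a) <= C * n.+1 ^ d)%N.
Proof.
move=> [_ [c1 [c2 [_ c2_gt0 [N _ HN]]]]].
(* The sum covers the finitely many lengths before the estimate starts to hold. *)
exists (Num.bound c2 + \sum_(k < N) size (morph_iter s k a))%N => n.
rewrite mulnDl; case: (ltnP n N) => nN.
  apply: leq_trans (leq_addl _ _); apply: leq_trans (leq_pmulr _ _).
    by rewrite (bigD1 (Ordinal nN)) //= leq_addr.
  by rewrite expn_gt0.
apply: leq_trans (leq_addr _ _); rewrite -(ler_nat R).
have /andP[_ h] := HN n nN; apply: le_trans h _.
rewrite expr1n mulr1 natrM natrX; apply: ler_pM; rewrite ?exprn_ge0 //.
- exact: ltW.
- exact/ltW/archi_boundP/ltW.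
- by rewrite lerXn2r ?nnegrE // ler_nat.
Qed.

Lemma polynomial_lower (A : finType) (s : A -> seq A) a d :
  letter_growth s a d (1 : R) ->
  exists C n0, forall n, (n0 <= n)%N -> (n ^ d <= C * size (morph_iter s n a))%N.
Proof.
move=> [_ [c1 [c2 [c1_gt0 _ [N _ HN]]]]].
exists (Num.bound c1^-1), N => n nN; rewrite -(ler_nat R).
have /andP[h _] := HN n nN; rewrite expr1n mulr1 in h.
rewrite natrM natrX; apply: (@le_trans _ _ (c1^-1 * (size (morph_iter s n a))%:R)).
  by rewrite mulrC ler_pdivlMr // mulrC.
by rewrite ler_wpM2r //; apply/ltW/archi_boundP; rewrite invr_ge0 ltW.
Qed.

Lemma exponential_position (A : finType) (s : A -> seq A) (y : nat -> A) i d (g : R) :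
  omega_image s y y -> 1 < g -> letter_growth s (y i) d g ->
  forall D E, exists n, (D * n.+1 ^ E < iter n (position A s y) i.+1)%N.
Proof.
move=> fix_y g1 [_ [c1 [c2 [c1_gt0 _ [N _ HN]]]]] D E.
(* Asking for [N.+1] makes [n] positive, so the factor [n ^ d] is at least 1. *)
have [n [nN hn]] := exp_beats_poly g c1 D E N.+1 g1 c1_gt0.
exists n; apply: (@leq_trans (size (morph_iter s n (y i)))); last first.
  by rewrite (morph_iter_subword _ _ _ fix_y) size_mkseq leq_subr.
rewrite -(ltr_nat R); have /andP[h _] := HN n (ltnW nN).
apply: lt_le_trans hn (le_trans _ h).
rewrite ler_pM2l // ler_peMl ?exprn_ge0 ?(le_trans ler01 (ltW g1)) //.
by rewrite -natrX ler1n expn_gt0 (leq_trans _ nN).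
Qed.

Lemma exponential_and_polynomial_substitutive (C : finType) (d e : nat) (g : R)
    (x : nat -> C) :
  1 < g -> e <> 0%N -> substitutive d g x -> substitutive e (1 : R) x ->
  ultimately_periodic x.
Proof.
move=> g1 e0.
move=> [A1 [s1 [y1 [phi1 [_ [ne1 [d1 [al1 [gr1 _ _ [a [ala _]]]]]] fix1 x1]]]]].
move=> [A2 [s2 [y2 [phi2 [_ [ne2 [d2 [al2 [gr2 le2 _ [b [_ db]]]]]] fix2 x2]]]]].
(* Every rate lies between 1 and the maximal rate 1, so all letters of [s2] grow polynomially. *)
have al2_1 c : al2 c = 1 by apply/le_anti; rewrite le2 (gr2 c).1.
have pol c : letter_growth s2 c (d2 c) (1 : R) by rewrite -(al2_1 c).
have [i yi] := fix1.2 a.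
apply: (exponential_polynomial _ _ _ s1 s2 y1 y2 phi1 phi2 d2 i.+1) => //.
- by apply: (exponential_position _ _ _ _ (d1 a) g fix1.1 g1); rewrite yi -ala.
- by move=> c; apply: polynomial_upper.
- by move=> c; apply: polynomial_lower.
- by exists b; rewrite db lt0n; apply/eqP.
Qed.

End Growth.

Theorem theorem26 (R : realType) (d e : nat) (alpha beta : R)
    (C : finType) (x : nat -> C) :
  d <> 0%N -> e <> 0%N -> 1 <= alpha -> 1 <= beta ->
  (d, alpha) <> (e, beta) -> (alpha, beta) <> (1, 1) ->
  (beta = 1 /\ e <> 0%N) \/ (alpha = 1 /\ d <> 0%N) ->
  substitutive d alpha x -> substitutive e beta x ->
  ultimately_periodic x.
Proof.
move=> _ _ alpha1 beta1 _ ab one sx tx.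
have strict (g : R) : 1 <= g -> g <> 1 -> 1 < g.
  by move=> g1 gn1; rewrite lt_neqAle g1 andbT eq_sym; apply/eqP.
(* One rate is 1; excluding the pair [(1, 1)] makes the other greater than 1. *)
case: one => [[b1 e0]|[a1 d0]].
  rewrite b1 in tx; apply: (exponential_and_polynomial_substitutive _ _ d e alpha) => //.
  by apply: strict => // a1; apply: ab; rewrite a1 b1.
rewrite a1 in sx; apply: (exponential_and_polynomial_substitutive _ _ e d beta) => //.
by apply: strict => // b1; apply: ab; rewrite a1 b1.
Qed.
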